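(* Let $S$ be a smooth surface, let $\phi:S\to Q$ be a smooth totally isotropic immersion into the quadric $Q\subset P(\mathbb{O})$ of isotropic lines of a split octonion algebra $\mathbb{O}$ over $\mathbb{R}$, and suppose that smooth maps $\psi,\psi_+,\psi_-:S\to\mathbb{O}\setminus\{0\}$ are given (which is always possible locally on $S$) such that $\psi$ lifts $\phi$ and such that, for every $p\in S$, the two maximal totally isotropic subspaces of $\mathbb{O}$ containing $V_p=\mathbb{R}\psi(p)+\mathrm{im}\,d\psi(p)$ are $\ker L_{\psi_+(p)}$ and $\ker R_{\psi_-(p)}$. (Thus $\psi_+\psi=0$, $\psi\psi_-=0$, $\psi_-\psi_+=0$, $\psi_+\,d\psi=0$, $d\psi\,\psi_-=0$, and by the Leibniz rule $d\psi_-\,\psi_++\psi_-\,d\psi_+=0$.) Then in fact $$d\psi_-\,\psi_+=\psi_-\,d\psi_+=0,$$ i.e. for every $p\in S$ and every $X\in T_pS$, $(d\psi_-(p)X)\,\psi_+(p)=0$ and $\psi_-(p)\,(d\psi_+(p)X)=0$ in $\mathbb{O}$.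
   Context: A split octonion algebra $\mathbb{O}$ over $\mathbb{R}$ is the 8-dimensional unital (non-associative) real algebra with a multiplicative quadratic form (norm) $N$ of signature $(4,4)$, with associated bilinear form $\langle\cdot,\cdot\rangle$. For $z\in\mathbb{O}$, $L_z$ and $R_z$ denote left and right multiplication by $z$: $L_zx=zx$, $R_zx=xz$. For $z\ne0$ isotropic ($N(z)=0$), $\ker L_z$ and $\ker R_z$ are maximal (4-dimensional) totally isotropic subspaces; every maximal totally isotropic subspace is of exactly one of these two forms, with $z$ unique up to a scalar. Every totally isotropic subspace of dimension 3 is contained in exactly two maximal totally isotropic subspaces, one of each form. $Q\subset P(\mathbb{O})$ is the projective quadric $\{[x]: N(x)=0\}$. An immersion $\phi:S\to Q$ is totally isotropic if the image of $T_p\phi$ is totally isotropic for the natural conformal structure of signature $(3,3)$ on $Q$ at every $p\in S$; equivalently, for any local lift $\psi$ of $\phi$ to $\mathbb{O}\setminus\{0\}$, the 3-dimensional subspace $V_p=\mathbb{R}\psi(p)+\mathrm{im}\,d\psi(p)$ is totally isotropic for $N$. *)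

(* Defs.v *)
From mathcomp Require Import all_boot all_order all_algebra.
From mathcomp Require Import all_classical all_reals all_analysis.
Set Implicit Arguments.
Unset Strict Implicit.
Unset Printing Implicit Defensive.
Import Order.TTheory GRing.Theory Num.Theory.
Import numFieldNormedType.Exports.
Local Open Scope classical_set_scope.
Local Open Scope ring_scope.

(* [Cn n U f] is meant for open U: 'D_v f is a total function, whose values on
   an open U depend only on f on U. *)
Fixpoint Cn (R : realType) (V W : normedModType R) (n : nat) (U : set V)
    (f : V -> W) : Prop :=
  match n with
  | 0 => forall x, U x -> {for x, continuous f}
  | n'.+1 => (forall x, U x -> differentiable f x) /\
             (forall v : V, Cn n' U ('D_v f))
  end.

Definition Cinfty (R : realType) (V W : normedModType R) (U : set V)
    (f : V -> W) : Prop := forall n, Cn n U f.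

Record chart (R : realType) (M : topologicalType) := Chart {
  chart_dom : set M;
  chart_cod : set 'rV[R]_2;
  chart_map : M -> 'rV[R]_2;
  chart_inv : 'rV[R]_2 -> M;
  chart_dom_open : open chart_dom;
  chart_cod_open : open chart_cod;
  chart_map_cod : forall p, chart_dom p -> chart_cod (chart_map p);
  chart_inv_dom : forall u, chart_cod u -> chart_dom (chart_inv u);
  chart_mapK : forall p, chart_dom p -> chart_inv (chart_map p) = p;
  chart_invK : forall u, chart_cod u -> chart_map (chart_inv u) = u;
  chart_map_cont : forall p, chart_dom p -> {for p, continuous chart_map};
  chart_inv_cont : forall u, chart_cod u -> {for u, continuous chart_inv}
}.

Record surface (R : realType) := Surface {
  surface_space :> topologicalType;
  surface_hausdorff : hausdorff_space surface_space;
  surface_countable : @second_countable surface_space;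
  atlas : set (chart R surface_space);
  atlas_cover : forall p, exists c, atlas c /\ chart_dom c p;
  atlas_compatible : forall c c', atlas c -> atlas c' ->
    Cinfty (chart_cod c `&` chart_inv c @^-1` chart_dom c')
           (chart_map c' \o chart_inv c)
}.
Arguments atlas {R} s.

(* A tangent vector at p is given by a representative (chart at p, coordinates
   in that chart). Several representatives denote the same vector, and the
   differential [dmap] of a smooth map takes the same value on all of them. *)
Record tangent (R : realType) (S : surface R) (p : S) := Tangent {
  tangent_chart : chart R S;
  tangent_atlas : atlas S tangent_chart;
  tangent_dom : chart_dom tangent_chart p;
  tangent_coord : 'rV[R]_2
}.

Section MapsToVectorSpace.
Context (R : realType) (S : surface R) (O : vectType R).

(* Calculus in O is done in the coordinates of the basis [vbasis {:O}]; any other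
   basis defines the same smooth maps and differentials. *)
Definition coords (x : O) : 'rV[R]_(\dim {:O}) :=
  passmx.rVof (vbasis {:O}) x.

Definition of_coords (u : 'rV[R]_(\dim {:O})) : O :=
  passmx.vecof (vbasis {:O}) u.

Definition smooth_on (W : set S) (f : S -> O) : Prop :=
  forall c, atlas S c ->
    Cinfty (chart_cod c `&` chart_inv c @^-1` W)
           (fun u => coords (f (chart_inv c u))).

Definition smooth (f : S -> O) : Prop := smooth_on setT f.

Definition dmap (f : S -> O) (p : S) (X : tangent p) : O :=
  let c := tangent_chart X in
  of_coords ('D_(tangent_coord X) (fun u => coords (f (chart_inv c u)))
         (chart_map c p)).

(* R f(p) + im df(p) *)
Definition osculating (f : S -> O) (p : S) : set O :=
  [set x | exists (a : R) (X : tangent p), x = a *: f p + dmap f X].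

End MapsToVectorSpace.

Section ProjectiveSpace.
Context (R : realType) (O : vectType R).

Record projspace := ProjSpace {
  line :> {vspace O};
  line_dim : (\dim line = 1)%N
}.

(* The affine charts of P(O): a linear form l gives the chart
   [x] |-> x / l x from {l <> 0} onto the affine hyperplane l = 1. *)
Definition affine_dom (l : 'Hom(O, R^o)) : set projspace :=
  [set L : projspace | ~~ (line L <= lker l)%VS].

Definition affine_coord (l : 'Hom(O, R^o)) (L : projspace) : O :=
  let x := vpick (line L) in ((l x : R)^-1) *: x.

Context (S : surface R).
Implicit Types phi : S -> projspace.

Definition smooth_proj phi : Prop :=
  forall l : 'Hom(O, R^o),
    open (phi @^-1` affine_dom l) /\
    smooth_on (phi @^-1` affine_dom l) (affine_coord l \o phi).

Definition immersion_proj phi : Prop :=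
  smooth_proj phi /\
  forall (l : 'Hom(O, R^o)) (p : S), affine_dom l (phi p) ->
    forall X : tangent p,
      dmap (affine_coord l \o phi) X = 0 -> tangent_coord X = 0.

Definition lifts_on (W : set S) (psi : S -> O) phi : Prop :=
  forall p, W p -> psi p != 0 /\ line (phi p) = <[psi p]>%VS.

End ProjectiveSpace.

Definition has_signature (R : realType) (O : vectType R) (m n : nat)
    (N : O -> R) : Prop :=
  exists e : (m + n).-tuple O, basis_of {:O} e /\
    forall x, N x = \sum_(i < m) coord e (lshift n i) x ^+ 2
                  - \sum_(j < n) coord e (rshift m j) x ^+ 2.

(* [oct_signature] makes [oct_norm] a quadratic form and O of dimension 8. *)
Record split_octonion (R : realType) (O : vectType R) := SplitOctonion {
  oct_mul : {bilinear O -> O -> O};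
  oct_one : O;
  oct_norm : O -> R;
  oct_mul1x : forall x, oct_mul oct_one x = x;
  oct_mulx1 : forall x, oct_mul x oct_one = x;
  oct_signature : has_signature 4 4 oct_norm;
  oct_normM : forall x y, oct_norm (oct_mul x y) = oct_norm x * oct_norm y
}.

Section SplitOctonions.
Context (R : realType) (O : vectType R) (A : split_octonion O).

Definition kerL (z : O) : {vspace O} :=
  lker (linfun (fun x => oct_mul A z x)).

Definition kerR (z : O) : {vspace O} :=
  lker (linfun (fun x => oct_mul A x z)).

Definition totally_isotropic (U : set O) : Prop :=
  forall x, U x -> oct_norm A x = 0.

Definition max_totally_isotropic (U : {vspace O}) : Prop :=
  totally_isotropic [set` U] /\
  forall W : {vspace O}, totally_isotropic [set` W] -> (U <= W)%VS -> W = U.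

Definition quadric : set (projspace O) :=
  [set L | totally_isotropic [set` line L]].

(* Q is a submanifold of P(O), so an immersion into Q is an immersion into P(O)
   with values in Q. *)
Definition totally_isotropic_immersion (S : surface R)
    (phi : S -> projspace O) : Prop :=
  [/\ immersion_proj phi,
      (forall p, quadric (phi p)) &
      forall (W : set S) (psi : S -> O), open W -> smooth_on W psi ->
        lifts_on W psi phi ->
        forall p, W p -> totally_isotropic (osculating psi p)].

End SplitOctonions.

(* Main.v *)
(* If psi a = 0 and b psi = 0, then a b lies in the line of the conjugate
   psi^-.  Leibniz puts psi_- and d psi_- in
   ker L_psi, psi_+ and d psi_+ in ker R_psi, so psi_- d psi_+ = alpha psi^- for a
   1-form alpha.  Its exterior derivative d psi_- /\ d psi_+ also takes values in
   the line of psi^-, hence alpha /\ d psi^- is 0 modulo psi^-.  Since phi is an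
   immersion, d psi is injective modulo psi, and on a surface this forces
   alpha = 0.  The same argument with the factors exchanged gives
   d psi_- psi_+ = 0. *)

From HB Require Import structures.
Require Import Defs.
From mathcomp Require Import all_boot all_order all_algebra.
From mathcomp Require Import all_classical all_reals all_analysis.
From mathcomp Require Import ring lra.
Set Implicit Arguments.
Unset Strict Implicit.
Unset Printing Implicit Defensive.
Import Order.TTheory GRing.Theory Num.Theory.
Import numFieldNormedType.Exports.
Local Open Scope classical_set_scope.
Local Open Scope ring_scope.

(** * Composition identities, conjugation, and kernels of multiplications *)

Section CompositionAlgebra.
Context (R : realType) (O : vectType R) (A : split_octonion O).
Local Notation N := (oct_norm A).
Local Notation "1O" := (oct_one A).
Local Notation "x ** y" := (oct_mul A x y) (at level 40, left associativity).

(** Normalised without the factor 1/2: [polar x x] equals [2 * N x]. *)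
Definition polar (x y : O) : R := N (x + y) - N x - N y.

Lemma polarC x y : polar x y = polar y x.
Proof. by rewrite /polar [x + y]addrC addrAC. Qed.

(** Bilinearity and nondegeneracy of [polar] are both read off from this diagonal form. *)
Lemma polar_coord (e : (4 + 4).-tuple O) :
  (forall x, N x = \sum_(i < 4) coord e (lshift 4 i) x ^+ 2
                 - \sum_(j < 4) coord e (rshift 4 j) x ^+ 2) ->
  forall x y, polar x y =
    \sum_(i < 4) 2 * coord e (lshift 4 i) x * coord e (lshift 4 i) y
    - \sum_(j < 4) 2 * coord e (rshift 4 j) x * coord e (rshift 4 j) y.
Proof.
move=> eN x y; rewrite /polar !eN !big_ord_recl !big_ord0 !linearD /=.
ring.
Qed.

Lemma polarP k x y z : polar (k *: x + y) z = k * polar x z + polar y z.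
Proof.
have [e [_ eN]] := oct_signature A.
rewrite !(polar_coord eN) !big_ord_recl !big_ord0 !linearP /= /GRing.scale/=.
ring.
Qed.

Lemma polarDl x y z : polar (x + y) z = polar x z + polar y z.
Proof. by rewrite -[x in LHS]scale1r polarP mul1r. Qed.

Lemma polar0l z : polar 0 z = 0.
Proof. by apply: (addrI (polar 0 z)); rewrite -polarDl !addr0. Qed.

Lemma polarZl k x z : polar (k *: x) z = k * polar x z.
Proof. by rewrite -[_ *: _]addr0 polarP polar0l addr0. Qed.

Lemma polarNl x z : polar (- x) z = - polar x z.
Proof. by rewrite -scaleN1r polarZl mulN1r. Qed.

Lemma polar_nondegenerate x : (forall z, polar x z = 0) -> x = 0.
Proof.
have [e [e_basis eN]] := oct_signature A => x0.
have e_free := basis_free e_basis.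
rewrite (coord_basis e_basis (memvf x)) big1 // => i _.
have := x0 e`_i; rewrite (polar_coord eN) !big_ord_recl !big_ord0 !coord_free //.
(* For each of the eight indices a single term of the two sums survives, the [i]-th coordinate of
   [x] times 2 or -2. *)
by case: i => -[|[|[|[|[|[|[|[|//]]]]]]]] lt_i /=;
  rewrite ?mulr0 ?mulr1 ?addr0 ?add0r ?subr0 ?sub0r => /eqP;
  rewrite ?oppr_eq0 mulf_eq0 pnatr_eq0 /= => /eqP;
  match goal with |- coord e ?a x = 0 -> coord e ?b x *: _ = 0 =>
    rewrite (_ : a = b) => [->|]; [rewrite scale0r|apply/val_inj] end.
Qed.

Lemma polar_inj x y : (forall z, polar x z = polar y z) -> x = y.
Proof.
move=> xy; apply/eqP; rewrite -subr_eq0; apply/eqP/polar_nondegenerate => z.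
by rewrite polarDl polarNl xy subrr.
Qed.

Lemma polar_mull x y z : polar (x ** y) (x ** z) = N x * polar y z.
Proof. by rewrite /polar -linearDr !oct_normM; ring. Qed.

(** Polarisation of [polar_mull] in the left factor: substitute [x + z] for [x] and cancel the terms
    pure in [x] and pure in [z]. *)
Lemma polar_exchange x y z w :
  polar (x ** y) (z ** w) + polar (x ** w) (z ** y) = polar x z * polar y w.
Proof.
have : polar ((x + z) ** y) ((x + z) ** w) = N (x + z) * polar y w.
  exact: polar_mull.
have polarDr a b c : polar a (b + c) = polar a b + polar a c.
  by rewrite polarC polarDl !(polarC a).
have N_D : N (x + z) = N x + N z + polar x z by rewrite /polar; ring.
rewrite !linearDl /= !polarDl !polarDr !polar_mull N_D (polarC (z ** y)).
lra.
Qed.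

(** [polar x 1O] is the trace of [x], so this is the usual octonion conjugate. *)
Definition oct_conj (x : O) : O := polar x 1O *: 1O - x.

Lemma oct_conj_is_linear : linear oct_conj.
Proof.
move=> k x y; rewrite /oct_conj polarP scalerDl -scalerA scalerBr.
by rewrite opprD addrACA.
Qed.
HB.instance Definition _ :=
  GRing.isLinear.Build R O O _ oct_conj oct_conj_is_linear.

(** The exchange identity with [1O] as third factor shows that conjugation turns a left
    multiplication into its adjoint; [1O] as fourth factor does the same on the right. *)
Lemma polar_mul_conjl x y z : polar (x ** y) z = polar y (oct_conj x ** z).
Proof.
have := polar_exchange x y 1O z; rewrite !oct_mul1x => h.
rewrite /oct_conj linearBl /= linearZl_LR /= oct_mul1x.
rewrite [RHS]polarC polarDl polarZl polarNl (polarC z) -h (polarC (x ** z)).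
by rewrite addrK.
Qed.

Lemma polar_mul_conjr x y z : polar (x ** y) z = polar x (z ** oct_conj y).
Proof.
have := polar_exchange x y z 1O; rewrite !oct_mulx1 => h.
rewrite /oct_conj linearBr /= linearZr_LR /= oct_mulx1.
rewrite [RHS]polarC polarDl polarZl polarNl (polarC z) mulrC -h.
by rewrite (polarC x) addrK.
Qed.

Lemma oct_conj_inj x : oct_conj x = 0 -> x = 0.
Proof.
move=> x0; rewrite -[x](oct_mulx1 A); apply: polar_nondegenerate => z.
by rewrite polar_mul_conjl x0 linear0l polarC polar0l.
Qed.

(** Pair with an arbitrary [z] and move the factors across by adjunction until [b ** x] appears. *)
Lemma conj_mul_conj_eq0 x b : b ** x = 0 -> oct_conj x ** oct_conj b = 0.
Proof.
move=> bx0; apply: polar_nondegenerate => z.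
rewrite polarC -polar_mul_conjl polar_mul_conjr -polar_mul_conjl bx0.
exact: polar0l.
Qed.

(** Nondegeneracy gives [w] with [polar x w] nonzero. As [x ** a = 0], one term of the exchange
    identity drops out and [oct_conj x ** (w ** a)] is [polar x w *: a]; dividing by the scalar
    gives [u]. *)
Lemma kerL_conj_image x a : x != 0 -> x ** a = 0 ->
  exists u, a = oct_conj x ** u.
Proof.
move=> x_neq0 xa0.
have [w xw] : exists w, polar x w != 0.
  apply: contrapT => /forallNP x_perp; move/eqP: x_neq0; apply.
  by apply: polar_nondegenerate => z; have /negP/negPn/eqP := x_perp z.
exists ((polar x w)^-1 *: (w ** a)); apply: polar_inj => z.
have := polar_exchange w a x z; rewrite xa0 (polarC _ 0) polar0l addr0 => h.
rewrite linearZr_LR /= polarZl [polar (oct_conj x ** _) _]polarC.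
by rewrite -polar_mul_conjl (polarC (x ** z)) h (polarC w) mulKf.
Qed.

(* For [a = x^- u], the exchange identity moves [b^-] onto [x^-], where it is
   killed because [x^- b^- = (b x)^- = 0]. *)
Lemma kerL_mul_kerR x a b : x != 0 -> x ** a = 0 -> b ** x = 0 ->
  exists k, a ** b = k *: oct_conj x.
Proof.
move=> x_neq0 xa0 bx0; have [u ->] := kerL_conj_image x_neq0 xa0.
exists (polar u (oct_conj b)); apply: polar_inj => z.
rewrite polar_mul_conjr polarZl mulrC.
have := polar_exchange (oct_conj x) u z (oct_conj b).
by rewrite (conj_mul_conj_eq0 bx0) polar0l addr0.
Qed.

End CompositionAlgebra.

(** * Symmetry of mixed directional derivatives *)

Section SecondDerivatives.
Context (R : realType) (V : normedModType R).

Lemma is_derive_line (W : normedModType R) (f : V -> W) (x v : V) (s : R) df :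
  is_derive (x + s *: v) v f df ->
  is_derive s 1 (fun r => f (x + r *: v)) df.
Proof.
have quotientE : (fun h : R => h^-1 *:
      (((fun r => f (x + r *: v)) \o shift s) (h *: (1 : R)) - f (x + s *: v))) =
    (fun h => h^-1 *: ((f \o shift (x + s *: v)) (h *: v) - f (x + s *: v))).
  apply/funext => h /=; congr (_ *: (f _ - _)).
  by rewrite [h *: 1]mulr1 scalerDl addrCA addrC.
case=> fv <-; apply: DeriveDef; first by rewrite /derivable quotientE.
by rewrite /derive quotientE.
Qed.

Lemma MVT_line (f df : V -> R) (x v : V) (t : R) : 0 < t ->
  (forall s, 0 <= s <= t -> is_derive (x + s *: v) v f (df (x + s *: v))) ->
  exists2 s, 0 < s < t & f (x + t *: v) - f x = df (x + s *: v) * t.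
Proof.
move=> t0 fdf.
have fline s : 0 <= s <= t ->
    is_derive s 1 (fun r => f (x + r *: v)) (df (x + s *: v)).
  by move=> st; apply: is_derive_line; apply: fdf.
have [||s st] := @MVT R (fun r => f (x + r *: v))
    (fun r => df (x + r *: v)) 0 t t0.
- by move=> s; rewrite in_itv /= => /andP[/ltW s0 /ltW st]; apply: fline; rewrite s0.
- apply: continuous_in_subspaceT => s; rewrite inE/= in_itv/= => st.
  apply: differentiable_continuous; apply/derivable1_diffP.
  by have [] := fline s st.
- by rewrite scale0r addr0 subr0 => fE; exists s => //; move: st; rewrite in_itv.
Qed.

(** Two mean value steps: along [v] for the increment [f (y + t *: w) - f y], then along [w] for
    [fv]. *)
Lemma second_difference (U : set V) (f fv fvw : V -> R) (x v w : V) (t : R) :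
  0 < t ->
  (forall s r, 0 <= s <= t -> 0 <= r <= t -> U (x + s *: v + r *: w)) ->
  (forall y, U y -> is_derive y v f (fv y)) ->
  (forall y, U y -> is_derive y w fv (fvw y)) ->
  exists s r, [/\ 0 <= s <= t, 0 <= r <= t &
    f (x + t *: v + t *: w) - f (x + t *: v) - (f (x + t *: w) - f x) =
    fvw (x + s *: v + r *: w) * t * t].
Proof.
move=> t0 xU fvP fvwP.
have tt : 0 <= t <= t by rewrite lexx ltW.
have zt : (0 : R) <= 0 <= t by rewrite lexx ltW.
pose g y := f (y + t *: w) - f y.
have [s st|s s_lt gE] := @MVT_line g (fun y => fv (y + t *: w) - fv y) x v t t0.
  have fsw : is_derive (x + s *: v) v (fun y => f (y + t *: w))
      (fv (x + s *: v + t *: w)).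
    have [fvd fve] := fvP _ (xU s t st tt).
    have E : (fun h : R => h^-1 *: (((fun y => f (y + t *: w)) \o shift (x + s *: v))
        (h *: v) - f (x + s *: v + t *: w))) =
      (fun h => h^-1 *: ((f \o shift (x + s *: v + t *: w)) (h *: v)
                  - f (x + s *: v + t *: w))).
      by apply/funext => h /=; rewrite !addrA.
    by apply: DeriveDef; [rewrite /derivable E|rewrite /derive E].
  have := xU s 0 st zt; rewrite scale0r addr0 => /fvP fs.
  exact: is_deriveB.
have st : 0 <= s <= t by case/andP: s_lt => /ltW-> /ltW->.
have [r rt|r r_lt fvE] := @MVT_line fv fvw (x + s *: v) w t t0.
  exact/fvwP/xU.
exists s, r; split=> //; first by case/andP: r_lt => /ltW-> /ltW->.
by rewrite -fvE -gE /g addrAC.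
Qed.

(** The second difference over a small parallelogram is symmetric in [v] and [w], so [fvw] and [fwv]
    agree at two points [y] and [y'] close to [x]; continuity at [x] transfers this to [x] up to any
    [e]. *)
Lemma mixed_derivatives_eq (U : set V) (f fv fw fvw fwv : V -> R) (x v w : V) :
  open U -> U x ->
  (forall y, U y -> is_derive y v f (fv y)) ->
  (forall y, U y -> is_derive y w f (fw y)) ->
  (forall y, U y -> is_derive y w fv (fvw y)) ->
  (forall y, U y -> is_derive y v fw (fwv y)) ->
  {for x, continuous fvw} -> {for x, continuous fwv} ->
  fvw x = fwv x.
Proof.
move=> Uopen Ux fvP fwP fvwP fwvP fvw_cont fwv_cont.
apply/eqP; rewrite -subr_eq0 -normr_le0; apply/ler_addgt0Pr => e e0.
rewrite add0r.
have e20 : 0 < e / 2 by rewrite divr_gt0.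
have : \forall y \near x, [/\ U y, `|fvw x - fvw y| < e / 2
    & `|fwv x - fwv y| < e / 2].
  near=> y; split; near: y; first exact: open_nbhs_nbhs.
  - by move/cvgrPdist_lt: fvw_cont; apply.
  - by move/cvgrPdist_lt: fwv_cont; apply.
move=> /nbhs_ballP[d /= d0 ballP].
(* The summand 1 keeps [M] positive even when [v] and [w] vanish; the choice of [t] then puts the
   whole parallelogram inside the ball of radius [d]. *)
pose M := `|v| + `|w| + 1.
have M0 : 0 < M by rewrite ltr_pwDr.
pose t := d / 2 / M.
have t0 : 0 < t by rewrite !divr_gt0.
have small (a b : V) s r : `|a| + `|b| = `|v| + `|w| ->
    0 <= s <= t -> 0 <= r <= t -> ball x d (x + s *: a + r *: b).
  move=> abE /andP[s0 st] /andP[r0 rt].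
  rewrite -ball_normE /= -addrA opprD addNKr normrN.
  apply: le_lt_trans (ler_normD _ _) _; rewrite !normrZ !ger0_norm //.
  apply: (@le_lt_trans _ _ (t * (`|a| + `|b|))).
    by rewrite mulrDr lerD // ler_wpM2r.
  apply: (@lt_le_trans _ _ (t * M)).
    by rewrite ltr_pM2l // abE ltrDl.
  by rewrite /t divfK ?gt_eqF // ler_pdivrMr // ler_peMr ?ler1n // ltW.
have [s [r [st rt]]] := @second_difference _ f fv fvw x v w t t0
  (fun s r st rt => small v w s r erefl st rt)
  (fun y By => let: And3 Uy _ _ := ballP y By in fvP y Uy)
  (fun y By => let: And3 Uy _ _ := ballP y By in fvwP y Uy).
have [s' [r' [st' rt']]] := @second_difference _ f fw fwv x w v t t0
  (fun s r st rt => small w v s r (addrC _ _) st rt)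
  (fun y By => let: And3 Uy _ _ := ballP y By in fwP y Uy)
  (fun y By => let: And3 Uy _ _ := ballP y By in fwvP y Uy).
set y' := x + s' *: w + _; set y := x + s *: v + _ => E' E.
have {E E'}fE : fvw y = fwv y'.
  apply: (mulIf (lt0r_neq0 t0)); apply: (mulIf (lt0r_neq0 t0)).
  by rewrite -E -E' [x + t *: v + _]addrAC; ring.
have [_ yP _] := ballP y (small v w s r erefl st rt).
have [_ _ y'P] := ballP y' (small w v s' r' (addrC _ _) st' rt').
rewrite (_ : _ - _ = (fvw x - fvw y) - (fwv x - fwv y')); last first.
  by rewrite fE; ring.
apply: le_trans (ler_normB _ _) _.
by rewrite [leRHS]splitr lerD // ltW.
Unshelve. all: by end_near. Qed.

End SecondDerivatives.

(** * Directional derivatives of maps into the algebra *)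

Section VectorValuedCalculus.
Context (R : realType) (V : normedModType R) (O : vectType R).
Local Notation b := (vbasis {:O}).

Lemma coordsE (x : O) i : coords x 0 i = coord b i x.
Proof. by rewrite mxE. Qed.

Lemma coordsK : cancel (@coords R O) (@of_coords R O).
Proof. exact/passmx.rVofK/vbasisP. Qed.

Lemma of_coordsK : cancel (@of_coords R O) (@coords R O).
Proof. exact/passmx.vecofK/vbasisP. Qed.

HB.instance Definition _ := GRing.isLinear.Build R _ _ _ (@of_coords R O)
  (passmx.vecof_linear b).

Lemma is_derive_rowP n (f : V -> 'rV[R]_n) x v d :
  is_derive x v f d <-> forall i, is_derive x v (fun y => f y 0 i) (d 0 i).
Proof.
split=> [[fv <-] i|fd].
  rewrite derive_mx // mxE; apply: derivableP.
  by move/derivable_mxP: fv; apply.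
have fv : derivable f x v.
  by apply/derivable_mxP => i j; rewrite (ord1 i); have [] := fd j.
apply: DeriveDef => //; rewrite derive_mx //; apply/rowP => j.
by rewrite mxE; have [_ ->] := fd j.
Qed.

(** [O] is a [vectType] without a norm, so derivatives are taken on coordinate rows, as in
    [dmap]. *)
Definition is_vderive (F : V -> O) x v (d : O) : Prop :=
  is_derive x v (fun y => coords (F y)) (coords d).

Definition vderive v (F : V -> O) x : O :=
  of_coords ('D_v (fun y => coords (F y)) x).

Lemma vderiveP F x v : derivable (fun y => coords (F y)) x v ->
  is_vderive F x v (vderive v F x).
Proof. by move=> Fv; rewrite /is_vderive of_coordsK; apply: derivableP. Qed.

Lemma vderive_val F x v d : is_vderive F x v d -> vderive v F x = d.
Proof. by case=> _ Fd; rewrite /vderive Fd coordsK. Qed.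

Lemma is_vderiveP F x v d : is_vderive F x v d <->
  forall i, is_derive x v (fun y => coord b i (F y)) (coord b i d).
Proof.
rewrite /is_vderive is_derive_rowP.
have E i : (fun y => coords (F y) 0 i) = (fun y => coord b i (F y)).
  by apply/funext => y; rewrite coordsE.
by split=> Fd i; have := Fd i; rewrite E coordsE.
Qed.

(** A linear form is a finite combination of basis coordinates with constant coefficients. *)
Lemma is_derive_scalar (l : {scalar O}) F x v d :
  is_vderive F x v d -> is_derive x v (fun y => l (F y)) (l d).
Proof.
move=> /is_vderiveP Fd.
have lE z : l z = \sum_i coord b i z * l b`_i.
  rewrite {1}(coord_vbasis (memvf z)) linear_sum.
  by apply: eq_bigr => i _; rewrite linearZ.
rewrite lE (_ : (fun y => _) =
    \sum_(i < \dim {:O}) (l b`_i \*: (fun y => coord b i (F y)))).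
  apply: is_derive_eq.
  by apply: eq_bigr => i _; rewrite [RHS]mulrC.
apply/funext => y; rewrite lE fct_sumE; apply: eq_bigr => i _.
by rewrite /= [RHS]mulrC.
Qed.

Lemma is_vderive_linear (L : {linear O -> O}) F x v d :
  is_vderive F x v d -> is_vderive (fun y => L (F y)) x v (L d).
Proof.
move=> Fd; apply/is_vderiveP => i.
exact: (is_derive_scalar (coord b i \o L)).
Qed.

(** Leibniz rule: expanding the first argument in the basis turns each coordinate of [m] into a
    finite sum of products of real functions. *)
Lemma is_vderive_bilinear (m : {bilinear O -> O -> O}) F G x v dF dG :
  is_vderive F x v dF -> is_vderive G x v dG ->
  is_vderive (fun y => m (F y) (G y)) x v (m dF (G x) + m (F x) dG).
Proof.
move=> Fd Gd; apply/is_vderiveP => k.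
have mE z w : coord b k (m z w) =
    \sum_(i < \dim {:O}) coord b i z * coord b k (m b`_i w).
  rewrite {1}(coord_vbasis (memvf z)) linear_sumlz linear_sum.
  by apply: eq_bigr => i _; rewrite linearZl_LR linearZ.
have mG i : is_derive x v (fun y => coord b k (m b`_i (G y)))
    (coord b k (m b`_i dG)).
  exact: (is_derive_scalar (coord b k \o m b`_i)).
move/is_vderiveP in Fd.
rewrite (_ : (fun y => _) = \sum_(i < \dim {:O}) ((fun y => coord b i (F y)) *
                 (fun y => coord b k (m b`_i (G y))))).
  apply: is_derive_eq.
  rewrite [RHS]linearD /= !mE -big_split /=; apply: eq_bigr => i _.
  by rewrite addrC; congr (_ + _); rewrite [LHS]mulrC.
apply/funext => y; rewrite mE fct_sumE; apply: eq_bigr => i _.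
by [].
Qed.

Lemma Cn_vderive n (U : set V) F v : Cn n.+1 U (fun y => coords (F y)) ->
  Cn n U (fun y => coords (vderive v F y)).
Proof.
move=> [_ /(_ v)]; congr Cn; apply/funext => y.
by rewrite /vderive of_coordsK.
Qed.

Lemma Cn_vderiveP n (U : set V) F v x : Cn n.+1 U (fun y => coords (F y)) ->
  U x -> is_vderive F x v (vderive v F x).
Proof. by case=> Fd _ /Fd xd; apply/vderiveP/diff_derivable. Qed.

Lemma vderiveD2 F x a c v w : differentiable (fun y => coords (F y)) x ->
  vderive (a *: v + c *: w) F x = a *: vderive v F x + c *: vderive w F x.
Proof.
by move=> Fd; rewrite /vderive !deriveE // !linearD !linearZ.
Qed.

(** Reduces to [mixed_derivatives_eq] in each coordinate; [Cn 2] supplies the continuity of both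
    mixed derivatives. *)
Lemma vderiveC (U : set V) F x v w : open U -> U x ->
  Cn 2 U (fun y => coords (F y)) ->
  vderive v (vderive w F) x = vderive w (vderive v F) x.
Proof.
move=> Uopen Ux FC.
have FvC v' := Cn_vderive v' FC.
have Fvw_cont v' w' :
    {for x, continuous (fun y => coords (vderive v' (vderive w' F) y))}.
  exact: (Cn_vderive v' (FvC w')).
have coord_cont (f : V -> 'rV[R]_(\dim {:O})) i :
    {for x, continuous f} -> {for x, continuous (fun y => f y 0 i)}.
  move=> fc; apply: (@continuous_comp _ _ _ f
    (fun r : 'rV[R]_(\dim {:O}) => r 0 i) x fc).
  exact: coord_continuous.
apply: (can_inj coordsK); apply/rowP => i.
have D G y v' : is_vderive G y v' (vderive v' G y) -> is_derive y v'
    (fun z => coords (G z) 0 i) (coords (vderive v' G y) 0 i).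
  by move/is_derive_rowP.
apply: (@mixed_derivatives_eq _ _ U (fun y => coords (F y) 0 i)
  (fun y => coords (vderive w F y) 0 i) (fun y => coords (vderive v F y) 0 i)
  (fun y => coords (vderive v (vderive w F) y) 0 i)
  (fun y => coords (vderive w (vderive v F) y) 0 i) x w v) => //.
- by move=> y Uy; apply/D/(Cn_vderiveP w FC).
- by move=> y Uy; apply/D/(Cn_vderiveP v FC).
- by move=> y Uy; apply/D/(Cn_vderiveP v (FvC w)).
- by move=> y Uy; apply/D/(Cn_vderiveP w (FvC v)).
- exact: coord_cont.
- exact: coord_cont.
Qed.

End VectorValuedCalculus.

(** * The exterior derivative argument on an open subset of the plane *)

Lemma scalar_inj (R : realType) (O : vectType R) (x y : O) :
  (forall l : {scalar O}, l x = l y) -> x = y.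
Proof.
move=> xy; rewrite (coord_vbasis (memvf x)) (coord_vbasis (memvf y)).
by apply: eq_bigr => i _; rewrite xy.
Qed.

(** The dimension of the surface enters here: a unit vector along a coordinate other than one where
    [v] is nonzero is independent of [v]. *)
Lemma exists_nonparallel (R : realType) (v : 'rV[R]_2) : v != 0 ->
  exists w : 'rV[R]_2, forall a c, a *: w = c *: v -> a = 0.
Proof.
move=> v0; have [i vi] : exists i, v 0 i != 0.
  by apply/existsP; rewrite -negb_forall; apply: contraNN v0 => /forallP v0;
    apply/eqP/rowP => i; rewrite mxE; apply/eqP.
have [j ji] : exists j : 'I_2, j != i.
  by exists (rev_ord i); case: i {vi} => -[|[|//]] ?.
exists (delta_mx 0 j) => a c acE.
have /rowP/(_ i) := acE; rewrite !mxE eqxx eq_sym (negPf ji) mulr0.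
move/esym/eqP; rewrite mulf_eq0 (negPf vi) orbF => /eqP c0.
by have /rowP/(_ j) := acE; rewrite !mxE !eqxx c0 mul0r mulr1.
Qed.

Lemma exists_scalar_neq0 (R : realType) (O : vectType R) (x : O) :
  x != 0 -> exists l : {scalar O}, l x != 0.
Proof.
move=> /eqP x0; apply: contrapT => /forallNP lx0; apply: x0.
apply: scalar_inj => l; rewrite linear0.
by have /negP/negPn/eqP := lx0 l.
Qed.

(** Stated for an arbitrary bilinear [m] so as to cover the octonion product and its flip. The
    factors [k] are given only pointwise, with no regularity, so the proportionality is
    differentiated after clearing denominators with a linear form [l] nonzero on [h x]. *)
Lemma proportional_derivative_eq0 (R : realType) (O : vectType R)
    (m : {bilinear O -> O -> O}) (U : set 'rV[R]_2) (f g h dh : 'rV[R]_2 -> O) x :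
  open U -> U x -> h x != 0 ->
  Cn 1 U (fun y => coords (f y)) ->
  Cn 2 U (fun y => coords (g y)) ->
  (forall v, is_vderive h x v (dh v)) ->
  (forall a c v w, dh (a *: v + c *: w) = a *: dh v + c *: dh w) ->
  (forall y v, U y -> exists k, m (f y) (vderive v g y) = k *: h y) ->
  (forall v w, exists k, m (vderive v f x) (vderive w g x) = k *: h x) ->
  (forall v k, dh v = k *: h x -> v = 0) ->
  forall v, m (f x) (vderive v g x) = 0.
Proof.
move=> Uopen Ux hx0 fC gC hP dh_linear propE dpropE h_imm.
have gvC v := Cn_vderive v gC.
have [l lh0] := exists_scalar_neq0 hx0.
(* [F v] is the value on [v] of the 1-form with values in the line of [h]; [dF w v] is its
   derivative along [w] at [x]. *)
pose F v y := m (f y) (vderive v g y).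
pose dF w v := m (vderive w f x) (vderive v g x)
  + m (f x) (vderive w (vderive v g) x).
have FP w v : is_vderive (F v) x w (dF w v).
  apply: is_vderive_bilinear; first exact: (Cn_vderiveP w fC).
  exact: (Cn_vderiveP w (gvC v)).
have scalarD2 (s : {scalar O}) a c (y z : O) :
    s (a *: y + c *: z) = a * s y + c * s z.
  by rewrite linearD /= !scalarZ.
(* Differentiate [l h * F v = l (F v) * h]. *)
have dE w v : l (dh w) *: F v x + l (h x) *: dF w v =
    l (dF w v) *: h x + l (F v x) *: dh w.
  apply: scalar_inj => lj; rewrite !scalarD2.
  have lF := is_derive_scalar l (FP w v); have lh := is_derive_scalar l (hP w).
  have ljF := is_derive_scalar lj (FP w v); have ljh := is_derive_scalar lj (hP w).
  have [_ E1] := is_deriveM lh ljF; have [_ E2] := is_deriveM lF ljh.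
  have E : 'D_w ((fun y => l (h y)) * (fun y => lj (F v y))) x =
           'D_w ((fun y => l (F v y)) * (fun y => lj (h y))) x.
    apply: near_eq_derive; near=> y.
    have Uy : U y by near: y; exact: open_nbhs_nbhs.
    have [k Fk] := propE y v Uy.
    change (l (h y) * lj (F v y) = l (F v y) * lj (h y)).
    by rewrite /F Fk !linearZ /= mulrCA mulrA.
  move: E; rewrite E1 E2 /GRing.scale /= => E.
  by rewrite (mulrC (l (dh w))) addrC E addrC (mulrC (lj (h x))).
move=> v; have [->|v0] := eqVneq v 0.
  by rewrite /vderive derive0 linear0 linear0r.
have [w wv] := exists_nonparallel v0.
have [kv Fv] := propE x v Ux; have [kw Fw] := propE x w Ux.
(* By the choice of [w] this relation forces [l (F v x) = 0], and [F v x] is a multiple of [h x], on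
   which [l] does not vanish. *)
suff /wv lFv0 : l (F v x) *: w = l (F w x) *: v.
  rewrite Fv; move/eqP: lFv0; rewrite /F Fv scalarZ mulf_eq0 (negPf lh0) orbF.
  by move=> /eqP ->; rewrite scale0r.
have [k1 dF1] := dpropE w v; have [k2 dF2] := dpropE v w.
(* Subtract [dE v w] from [dE w v]: apart from the two terms in [dh], everything is a multiple of
   [h x], and [K] is the total coefficient. The immersion hypothesis then applies to the combination
   of [w] and [v]. *)
pose K := l (dh w) * kv - l (dh v) * kw + l (h x) * (k1 - k2)
  - (l (dF w v) - l (dF v w)).
apply/eqP; rewrite -subr_eq0; apply/eqP/(h_imm _ K).
rewrite -scaleNr dh_linear.
(* The second derivatives of [g] cancel by symmetry; only products of first derivatives remain. *)
have dFB : dF w v - dF v w = (k1 - k2) *: h x.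
  by rewrite scalerBl -dF1 -dF2 /dF (vderiveC v w Uopen Ux gC)
    [X in _ - X]addrC addrKA.
have combine (a b c p q H Hv Hw D1 D2 r s : R) :
    a * (kv * H) + c * D1 = p * H + r * Hw ->
    b * (kw * H) + c * D2 = q * H + s * Hv -> D1 - D2 = (k1 - k2) * H ->
    r * Hw + - s * Hv = (a * kv - b * kw + c * (k1 - k2) - (p - q)) * H.
  by move=> E1 E2 /(canRL (subrK _)) D1E; rewrite D1E in E1; lra.
(* Under an arbitrary linear form [lj] the vector identity becomes the real identity [combine]. *)
apply: scalar_inj => lj; rewrite scalarD2 scalarZ.
apply: (combine (l (dh w)) (l (dh v)) (l (h x))
  (l (dF w v)) (l (dF v w)) (lj (h x)) _ _ (lj (dF w v)) (lj (dF v w))).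
- by rewrite -[kv * _]scalarZ -Fv -!scalarD2 dE.
- by rewrite -[kw * _]scalarZ -Fw -!scalarD2 dE.
- by rewrite -[RHS]scalarZ -dFB linearB.
Unshelve. all: by end_near. Qed.

Lemma is_vderive_locally0 (R : realType) (V : normedModType R) (O : vectType R)
    (U : set V) (F : V -> O) x v d : open U -> U x -> (forall y, U y -> F y = 0) ->
  is_vderive F x v d -> d = 0.
Proof.
move=> Uopen Ux F0 /vderive_val <-.
rewrite /vderive (@near_eq_derive _ _ _ _ (cst 0)) ?derive_cst ?linear0 //.
near=> y; rewrite F0; first by apply/rowP => i; rewrite coordsE linear0 mxE.
by near: y; exact: open_nbhs_nbhs.
Unshelve. all: by end_near. Qed.

(** The opposite product, which brings a product whose differentiated factor is on the left under
    [proportional_derivative_eq0]. *)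
Definition flip_bilinear (R : realType) (O : vectType R)
  (m : {bilinear O -> O -> O}) (x y : O) : O := m y x.

Lemma flip_bilinear_subproof (R : realType) (O : vectType R)
  (m : {bilinear O -> O -> O}) : bilinear_for *:%R *:%R (flip_bilinear m).
Proof. by split=> z a x y; rewrite /flip_bilinear ?linearPr ?linearPl. Qed.

HB.instance Definition _ (R : realType) (O : vectType R)
    (m : {bilinear O -> O -> O}) :=
  bilinear_isBilinear.Build R O O O *:%R *:%R (flip_bilinear m)
    (flip_bilinear_subproof m).

(** * Passage to a chart of the surface, and the conclusion *)

Section InAChart.
Context (R : realType) (O : vectType R) (S : surface R) (c : chart R S).
Hypothesis c_atlas : atlas S c.
Local Notation pull F := (fun u => F (chart_inv c u)).

Lemma smooth_Cn (F : S -> O) n : smooth F ->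
  Cn n (chart_cod c) (fun u => coords (F (chart_inv c u))).
Proof. by move=> /(_ c c_atlas n); rewrite preimage_setT setIT. Qed.

Lemma dmap_vderive (F : S -> O) u v (cu : chart_cod c u) :
  dmap F (Tangent c_atlas (chart_inv_dom cu) v) = vderive v (pull F) u.
Proof. by rewrite /dmap /= chart_invK. Qed.

(** In the affine chart of a form [l] the map [phi] reads [psi / l psi]. By the quotient rule its
    derivative vanishes where that of [psi] is a multiple of [psi], so the immersion property
    applies. *)
Lemma lift_immersion (phi : S -> projspace O) (psi : S -> O) u v k :
  immersion_proj phi -> smooth psi -> lifts_on setT psi phi -> chart_cod c u ->
  vderive v (pull psi) u = k *: psi (chart_inv c u) -> v = 0.
Proof.
move=> [_ phi_imm] psi_smooth psi_lift cu dpsi.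
set q := chart_inv c u in dpsi *.
have [psi_q _] := psi_lift q I.
have [l lq] := exists_scalar_neq0 psi_q.
pose L : 'Hom(O, R^o) := linfun l.
have LE x : L x = l x by rewrite lfunE.
have coordE : affine_coord L \o phi = fun y => (l (psi y))^-1 *: psi y.
  apply/funext => y /=; rewrite /affine_coord LE.
  have [psi_y ->] := psi_lift y I.
  (* The generator picked in [affine_coord] is an unknown nonzero multiple [a] of [psi y]; the
     factor [a] cancels in the quotient. *)
  have /vlineP[a aE] := memv_pick <[psi y]>%VS.
  have a0 : a != 0.
    apply: contraNneq psi_y => a0; move: aE; rewrite a0 scale0r => /eqP.
    rewrite vpick0 => /eqP y0; have := memv_line (psi y).
    by rewrite y0 memv0.
  by rewrite aE scalarZ invfM scalerA mulrAC mulVf // mul1r.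
have dom : affine_dom L (phi q).
  have [_ E] := psi_lift q I.
  by rewrite /affine_dom /= E -memvE memv_ker LE.
apply: (phi_imm L q dom (Tangent c_atlas (chart_inv_dom cu) v)).
rewrite dmap_vderive coordE.
have psiP := Cn_vderiveP v (smooth_Cn 1 psi_smooth) cu.
apply: vderive_val; apply/is_vderiveP => i.
have li := is_derive_scalar (coord (vbasis {:O}) i) psiP.
have ll := is_derive_scalar l psiP.
have lV : is_derive u v (fun y => (l (psi (chart_inv c y)))^-1)
    (- (l (psi q)) ^- 2 * l (vderive v (pull psi) u)).
  case: ll => ld lE; apply: DeriveDef; first exact: derivableV.
  by rewrite deriveV // lE.
have E : (fun y => coord (vbasis {:O}) i
      ((l (psi (chart_inv c y)))^-1 *: psi (chart_inv c y))) =
    (fun y => (l (psi (chart_inv c y)))^-1) *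
    (fun y => coord (vbasis {:O}) i (psi (chart_inv c y))).
  by apply/funext => y; rewrite scalarZ.
rewrite E; apply: is_derive_eq; rewrite linear0 dpsi !scalarZ -/q /GRing.scale /=.
by field.
Qed.

End InAChart.

(** Both kernels contain the osculating space, hence [psi p] and [dmap psi X]. *)
Lemma osculating_mul_eq0 (R : realType) (O : vectType R) (A : split_octonion O)
    (S : surface R) (psi : S -> O) (p : S) (a b : O) (X : tangent p) :
  (forall U : {vspace O},
     (max_totally_isotropic A U /\ osculating psi p `<=` [set` U]) <->
     (U = kerL A a \/ U = kerR A b)) ->
  [/\ oct_mul A a (psi p) = 0, oct_mul A a (dmap psi X) = 0,
      oct_mul A (psi p) b = 0 & oct_mul A (dmap psi X) b = 0].
Proof.
move=> maxE.
have [_ sub_a] := (maxE _).2 (or_introl erefl).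
have [_ sub_b] := (maxE _).2 (or_intror erefl).
have inL x : x \in kerL A a -> oct_mul A a x = 0.
  by rewrite memv_ker lfunE => /eqP.
have inR x : x \in kerR A b -> oct_mul A x b = 0.
  by rewrite memv_ker (lfunE (applyr (oct_mul A) b)) => /eqP.
have osc_d : osculating psi p (dmap psi X).
  by exists 0, X; rewrite scale0r add0r.
(* Elements of [osculating] carry a tangent vector; the zero vector in the chart of [X] serves
   here. *)
have osc_psi : osculating psi p (psi p).
  exists 1, (Tangent (tangent_atlas X) (tangent_dom X) 0).
  by rewrite scale1r /dmap /= derive0 linear0 addr0.
by split; [apply/inL/sub_a|apply/inL/sub_a|apply/inR/sub_b|apply/inR/sub_b].
Qed.

Theorem proposition6 (R : realType) (O : vectType R) (A : split_octonion O)
    (S : surface R) (phi : S -> projspace O) (psi psip psim : S -> O)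
    (phi_isotropic : totally_isotropic_immersion A phi)
    (psi_smooth : smooth psi)
    (psip_smooth : smooth psip)
    (psim_smooth : smooth psim)
    (psip_neq0 : forall p, psip p != 0)
    (psim_neq0 : forall p, psim p != 0)
    (psi_lift : lifts_on setT psi phi)
    (two_maximal : forall p : S,
       kerL A (psip p) <> kerR A (psim p) /\
       forall U : {vspace O},
         (max_totally_isotropic A U /\ osculating psi p `<=` [set` U]) <->
         (U = kerL A (psip p) \/ U = kerR A (psim p))) :
  forall (p : S) (X : tangent p),
    oct_mul A (dmap psim X) (psip p) = 0 /\
    oct_mul A (psim p) (dmap psip X) = 0.
Proof.
move=> p [c c_atlas cp v].
have [phi_imm _ _] := phi_isotropic.
pose U := chart_cod c; pose u := chart_map c p.
have Uopen : open U := @chart_cod_open _ _ c.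
have Uu : U u := chart_map_cod cp.
pose f0 y := psi (chart_inv c y); pose fp y := psip (chart_inv c y).
pose fm y := psim (chart_inv c y).
have f0_neq0 y : f0 y != 0 by have [] := psi_lift (chart_inv c y) I.
have f0C n : Cn n U (fun y => coords (f0 y)) := smooth_Cn c_atlas n psi_smooth.
have fpC n : Cn n U (fun y => coords (fp y)) := smooth_Cn c_atlas n psip_smooth.
have fmC n : Cn n U (fun y => coords (fm y)) := smooth_Cn c_atlas n psim_smooth.
have nullE y w : U y -> [/\ oct_mul A (fp y) (f0 y) = 0,
    oct_mul A (fp y) (vderive w f0 y) = 0, oct_mul A (f0 y) (fm y) = 0 &
    oct_mul A (vderive w f0 y) (fm y) = 0].
  move=> Uy; rewrite -(dmap_vderive c_atlas psi w Uy).
  exact: osculating_mul_eq0 (two_maximal _).2.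
(* Leibniz on [fp * f0 = 0], where the term with the derivative of [f0] is already zero. The next
   claim treats [f0 * fm = 0] in the same way. *)
have dfp_f0 y w : U y -> oct_mul A (vderive w fp y) (f0 y) = 0.
  move=> Uy; have [_ fp_df0 _ _] := nullE y w Uy.
  have := is_vderive_bilinear (oct_mul A) (Cn_vderiveP w (fpC 1) Uy)
    (Cn_vderiveP w (f0C 1) Uy).
  rewrite fp_df0 addr0; apply: (is_vderive_locally0 Uopen Uy) => z Uz.
  by have [] := nullE z w Uz.
have f0_dfm y w : U y -> oct_mul A (f0 y) (vderive w fm y) = 0.
  move=> Uy; have [_ _ _ df0_fm] := nullE y w Uy.
  have := is_vderive_bilinear (oct_mul A) (Cn_vderiveP w (f0C 1) Uy)
    (Cn_vderiveP w (fmC 1) Uy).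
  rewrite df0_fm add0r; apply: (is_vderive_locally0 Uopen Uy) => z Uz.
  by have [] := nullE z w Uz.
(* Conjugation is linear and injective, so [h] inherits from [f0] nonvanishing, smoothness and
   injectivity of the differential modulo its own line. *)
pose h y := oct_conj A (f0 y).
pose dh w := oct_conj A (vderive w f0 u).
have conj_neq0 : h u != 0.
  by apply: contraNneq (f0_neq0 u) => /oct_conj_inj ->.
have hP w : is_vderive h u w (dh w).
  exact/is_vderive_linear/(Cn_vderiveP w (f0C 1)).
have dh_linear a b w w' : dh (a *: w + b *: w') = a *: dh w + b *: dh w'.
  have conjD2 y z : oct_conj A (a *: y + b *: z) =
      a *: oct_conj A y + b *: oct_conj A z by rewrite linearD /= !linearZ.
  by rewrite -conjD2 -(vderiveD2 _ _ _ _ ((f0C 1).1 u Uu)).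
have h_imm w k : dh w = k *: h u -> w = 0.
  move=> /eqP; rewrite -subr_eq0 /dh /h -linearZ -linearB => /eqP/oct_conj_inj/eqP.
  rewrite subr_eq0 => /eqP.
  exact: (lift_immersion c_atlas phi_imm psi_smooth psi_lift Uu).
have pE : chart_inv c u = p := chart_mapK cp.
have -> : dmap psim (Tangent c_atlas cp v) = vderive v fm u by [].
have -> : dmap psip (Tangent c_atlas cp v) = vderive v fp u by [].
have -> : psip p = fp u by rewrite /fp pE.
have -> : psim p = fm u by rewrite /fm pE.
split.
(* The flipped product with [f = fp] and [g = fm]: the derivative of [fm] lies in the kernel of left
   multiplication by [f0], while [fp] and its derivative lie in that of right multiplication. *)
- apply: (@proportional_derivative_eq0 _ _ (flip_bilinear (oct_mul A))
    U fp fm h dh) => //.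
  + move=> y w Uy; have [fp_f0 _ _ _] := nullE y w Uy.
    exact: kerL_mul_kerR (f0_neq0 y) (f0_dfm y w Uy) fp_f0.
  + move=> w w'; apply: (kerL_mul_kerR (f0_neq0 u)); [exact: f0_dfm|exact: dfp_f0].
(* Now [fm] is the undifferentiated factor and [fp] the differentiated one, in the original order of
   multiplication. *)
- apply: (@proportional_derivative_eq0 _ _ (oct_mul A) U fm fp h dh) => //.
  + move=> y w Uy; have [_ _ f0_fm _] := nullE y w Uy.
    exact: kerL_mul_kerR (f0_neq0 y) f0_fm (dfp_f0 y w Uy).
  + move=> w w'; apply: (kerL_mul_kerR (f0_neq0 u)); [exact: f0_dfm|exact: dfp_f0].
Qed.
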